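(* Let $G\cong(\underbrace{0,\ldots,0}_{k_1},1,\underbrace{0,\ldots,0}_{k_2},1,\underbrace{0,\ldots,0}_{k_3},1)$ be a threshold graph of order $n$ with $k_1,k_2,k_3\ge 1$. Then $q(G)\le 4$.
   Context: For a simple graph $G$ on $n$ vertices, $S(G)$ is the set of all real symmetric $n\times n$ matrices $A=(a_{ij})$ such that for $i\neq j$, $a_{ij}\neq 0$ if and only if $ij\in E(G)$ (diagonal entries are unrestricted). $q(A)$ is the number of distinct eigenvalues of $A$ and $q(G)=\min\{q(A): A\in S(G)\}$. The notation $G\cong(b_1,\ldots,b_n)$, with $b_i\in\{0,1\}$ and $b_1=0$, means that $G$ is the threshold graph with creation sequence $(b_1,\ldots,b_n)$: its vertices are $v_1,\ldots,v_n$ and, for $i<j$, $v_i$ and $v_j$ are adjacent if and only if $b_j=1$. *)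

(* Defs.v *)
From mathcomp Require Import all_boot all_order all_fingroup all_algebra finmap.
From mathcomp Require Import boolp classical_sets cardinality reals.

Set Implicit Arguments.
Unset Strict Implicit.
Unset Printing Implicit Defensive.

Import GRing.Theory Num.Theory.
Local Open Scope ring_scope.

Record sgraph (n : nat) := SGraph {
  adj :> rel 'I_n;
  adj_sym : symmetric adj;
  adj_irr : irreflexive adj }.

(* The vertex v_(i+1) of the mathematical notation is [v i], and the term
   b_(i+1) of the creation sequence is [nth false b i]. *)
Definition is_threshold (n : nat) (G : sgraph n) (b : seq bool) : Prop :=
  [/\ size b = n, ohead b = Some false &
    exists v : 'S_n, forall i j : 'I_n, (i < j)%N ->
      G (v i) (v j) = nth false b j].

Section InverseEigenvalueProblem.
Variable R : realType.

Definition symm_class (n : nat) (G : sgraph n) : set 'M[R]_n :=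
  [set A | A^T = A /\ forall i j, i != j -> (A i j != 0) = G i j]%classic.

(* [fset_set] maps an infinite set to the empty one; [eigenvalues_finite]
   shows that this default is never reached. *)
Definition num_eigenvalues (n : nat) (A : 'M[R]_n) : nat :=
  #|` fset_set [set a | eigenvalue A a]%classic |.

Lemma eigenvalues_finite (n : nat) (A : 'M[R]_n) :
  finite_set [set a | eigenvalue A a]%classic.
Proof.
apply: contrapT => /(infinite_set_fset n.+1)[B sBA leB].
have: (size (enum_fset B) < size (char_poly A))%N.
  apply: max_poly_roots; last exact: fset_uniq.
    exact/monic_neq0/char_poly_monic.
  by apply/allP => a /sBA; rewrite /= eigenvalue_root_char.
by rewrite size_char_poly ltnNge leB.
Qed.

Lemma symm_class_nonempty (n : nat) (G : sgraph n) :
  exists k, `[< exists2 A, symm_class G A & num_eigenvalues A = k >].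
Proof.
pose A : 'M[R]_n := \matrix_(i, j) (G i j)%:R.
exists (num_eigenvalues A); apply/asboolP; exists A => //; split.
  by apply/matrixP => i j; rewrite !mxE adj_sym.
by move=> i j _; rewrite mxE pnatr_eq0 eqb0 negbK.
Qed.

Definition min_num_eigenvalues (n : nat) (G : sgraph n) : nat :=
  ex_minn (symm_class_nonempty G).

End InverseEigenvalueProblem.

(* Main.v *)
Require Import Defs.
From mathcomp Require Import all_boot all_order all_algebra.
From mathcomp Require Import reals.
From mathcomp Require Import all_fingroup finmap boolp classical_sets.
From mathcomp Require Import cardinality ring lra.

(** The matrix A = [[0, B], [B^T, J]] works, where the rows of B are indexed by
    the nonadjacent vertices, its three columns by the dominating ones, J is the
    3 x 3 all-ones matrix, B is constant on each of the three independent blocks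
    and B^T B = I + J.  Such a B with the required zero pattern is the
    upper-triangular Cholesky factor of I + J, each row being spread evenly over
    a block.  For a row eigenvector (p, r) with eigenvalue a, eliminating p gives
    (a + 1) ((a - 1) r - r J) = 0, hence a is 0, 1, -1 or 4. *)

Set Implicit Arguments.
Unset Strict Implicit.
Unset Printing Implicit Defensive.

Import Order.TTheory GRing.Theory Num.Theory.
Local Open Scope ring_scope.

(** * Nonzero spectrum of a blow-up *)

Section Blowup.
Variables (F : fieldType) (n m : nat) (f : 'I_n -> 'I_m).

Definition fiber_sizes : 'rV[F]_m := \row_c #|[pred i | f i == c]|%:R.

(* With P the incidence matrix of [f], the blow-up is P W P^T and P^T P is the
   diagonal of fibre sizes; P (W P^T) and (W P^T) P have the same nonzero
   eigenvalues. *)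
Lemma eigenvalue_mxsub (W : 'M[F]_m) (a : F) :
  a != 0 -> eigenvalue (mxsub f f W) a ->
  eigenvalue (W *m diag_mx fiber_sizes) a.
Proof.
move=> a0 /eigenvalueP[u uE u0]; pose P : 'M[F]_(n, m) := rowsub f 1%:M.
have PE i c : P i c = (f i == c)%:R by rewrite !mxE.
have subE : mxsub f f W = P *m W *m P^T.
  apply/matrixP => i j; rewrite !mxE (bigD1 (f j)) //= [X in _ + X]big1 => [|c cj].
    rewrite [P^T _ _]mxE PE eqxx mulr1 addr0 mxE (bigD1 (f i)) //= PE eqxx mul1r.
    rewrite big1 ?addr0 // => c ci.
    by rewrite PE eq_sym (negbTE ci) mul0r.
  by rewrite [P^T _ _]mxE PE eq_sym (negbTE cj) mulr0.
have diagE : P^T *m P = diag_mx fiber_sizes.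
  apply/matrixP => c d; rewrite !mxE -sum1_card natr_sum.
  rewrite -sumrMnl [RHS]big_mkcond /=; apply: eq_bigr => i _.
  rewrite [P^T _ _]mxE !PE inE.
  by case: eqVneq => [->|_]; rewrite ?mul1r ?mul0r.
rewrite subE !mulmxA in uE; apply/eigenvalueP; exists (u *m P).
  by rewrite -diagE !mulmxA uE scalemxAl.
apply: contra_neq u0 => uP0; rewrite uP0 !mul0mx in uE.
by have /eqP := esym uE; rewrite scaler_eq0 (negbTE a0) => /eqP.
Qed.

End Blowup.

Lemma pairwise_nseq (T : Type) (r : rel T) k x :
  r x x -> pairwise r (nseq k x).
Proof. by move=> rxx; elim: k => //= k ->; rewrite all_nseq rxx orbT. Qed.

Lemma num_eigenvalues_le (R : realType) n (A : 'M[R]_n) (s : seq R) :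
  (forall a, eigenvalue A a -> a \in s) -> (num_eigenvalues A <= size s)%N.
Proof.
move=> sA; apply: uniq_leq_size; first exact: fset_uniq.
move=> a; rewrite in_fset_set; last exact: eigenvalues_finite.
by rewrite inE /= => /sA.
Qed.

Lemma min_num_eigenvalues_le (R : realType) n (G : sgraph n) (A : 'M[R]_n) :
  symm_class G A -> (min_num_eigenvalues R G <= num_eigenvalues A)%N.
Proof.
move=> GA; rewrite /min_num_eigenvalues; case: ex_minnP => k _; apply.
by apply/asboolP; exists A.
Qed.

(** * The weighted quotient on six cells *)

Section Quotient.
Variables (R : realType) (k1 k2 k3 : nat).
Hypotheses (k1_gt0 : (0 < k1)%N) (k2_gt0 : (0 < k2)%N) (k3_gt0 : (0 < k3)%N).

Local Notation cell i := (@Ordinal 6 i isT).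

(** The cells are listed in creation order of the vertices, so the parities of the entries form the
    creation sequence. *)
Definition cells : seq 'I_6 :=
  nseq k1 (cell 0) ++ [:: cell 1] ++ nseq k2 (cell 2) ++ [:: cell 3]
    ++ nseq k3 (cell 4) ++ [:: cell 5].

Lemma cells_sorted : pairwise (fun c d : 'I_6 => (c <= d)%N) cells.
Proof.
rewrite /cells !pairwise_cat !pairwise_nseq // /allrel.
by do 3! rewrite /= ?all_cat ?all_nseq ?orbT.
Qed.

Lemma count_cells c : count_mem c cells = nth 0%N [:: k1; 1; k2; 1; k3; 1]%N c.
Proof.
rewrite /cells !count_cat !count_nseq /=.
by case: c => -[|[|[|[|[|[|c]]]]]] i //=; rewrite ?mul0n ?mul1n ?addn0 ?add0n.
Qed.

(** [I + J] is the sum of [r^T r] over [r] = (2,1,1), (0,3,1), (0,0,1) with weights 1/2, 1/6, 4/3;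
    each weight is shared equally by the vertices of a block. The last branch serves cell 4. *)
Definition scale (c : nat) : R :=
  match c with
  | 0 => Num.sqrt (2 * k1%:R)^-1
  | 2 => Num.sqrt (6 * k2%:R)^-1
  | _ => Num.sqrt (4 / (3 * k3%:R))
  end.
Arguments scale : simpl never.

(* Odd indices are the dominating vertices, even ones the blocks; row 2i is a
   rescaled row i of the Cholesky factor [[2,1,1],[0,3,1],[0,0,1]] of I + J,
   where [scale] accounts for the block size, see [scale_sq]. *)
Definition upper_weight (c d : nat) : R :=
  if ~~ odd d then 0 else if odd c then 1 else
  match c, d with
  | 0, 1 => 2 * scale 0
  | 2, 3 => 3 * scale 2
  | _, _ => scale c
  end.

Definition weight : 'M[R]_6 :=
  \matrix_(c, d) if (c <= d)%N then upper_weight c d else upper_weight d c.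

Lemma weight_sym : weight^T = weight.
Proof.
apply/matrixP => c d; rewrite !mxE.
by case: (ltngtP c d) => // ->.
Qed.

Lemma scale_gt0 c : 0 < scale c.
Proof.
by case: c => [|[|[|c]]]; rewrite sqrtr_gt0 ?divr_gt0 ?invr_gt0 ?mulr_gt0 ?ltr0n.
Qed.

Lemma weight_neq0 (c d : 'I_6) : (c <= d)%N -> (weight c d != 0) = odd d.
Proof.
move=> cd; rewrite mxE cd /upper_weight; case: (odd d); last by rewrite eqxx.
case: (odd c); rewrite ?oner_neq0 // gt_eqF //.
have gt0 k e : 0 < k.+1%:R * scale e by rewrite mulr_gt0 ?scale_gt0 ?ltr0n.
by case: (nat_of_ord c) (nat_of_ord d) => [|[|[|?]]] [|[|[|[|?]]]];
  (exact: gt0 || exact: scale_gt0).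
Qed.

Lemma sum_cells (g : 'I_6 -> R) : \sum_c g c =
  g (cell 0) + g (cell 1) + g (cell 2) + g (cell 3) + g (cell 4) + g (cell 5).
Proof.
rewrite !big_ord_recl big_ord0 addr0 !addrA.
by do ! congr (_ + _); congr g; apply: val_inj.
Qed.

Lemma scale_sq :
  [/\ scale 0 * scale 0 * k1%:R = 2^-1, scale 2 * scale 2 * k2%:R = 6^-1
    & scale 4 * scale 4 * k3%:R = 4 / 3].
Proof.
have [n1 n2 n3] : [/\ k1%:R != 0 :> R, k2%:R != 0 :> R & k3%:R != 0 :> R].
  by rewrite !pnatr_eq0 -!lt0n.
rewrite -!expr2 !sqr_sqrtr ?divr_ge0 ?invr_ge0 ?mulr_ge0 ?ler0n //.
by split; field; rewrite ?n1 ?n2 ?n3.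
Qed.

(** These are the row eigenvector equations of the quotient, with scales [s] and block sizes [l];
    the blocks carry the even unknowns. *)
Lemma quotient_kernel (a s1 s2 s3 l1 l2 l3 x0 x1 x2 x3 x4 x5 : R) :
  a \notin [:: 0; 1; -1; 4] ->
  s1 * s1 * l1 = 2^-1 -> s2 * s2 * l2 = 6^-1 -> s3 * s3 * l3 = 4 / 3 ->
  s1 * l1 * (2 * x1 + x3 + x5) = a * x0 ->
  2 * s1 * x0 + (x1 + x3 + x5) = a * x1 ->
  s2 * l2 * (3 * x3 + x5) = a * x2 ->
  s1 * x0 + 3 * s2 * x2 + (x1 + x3 + x5) = a * x3 ->
  s3 * l3 * x5 = a * x4 ->
  s1 * x0 + s2 * x2 + s3 * x4 + (x1 + x3 + x5) = a * x5 ->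
  [/\ x1 = 0, x3 = 0 & x5 = 0] /\ [/\ x0 = 0, x2 = 0 & x4 = 0].
Proof.
rewrite !inE !negb_or => /and4P[a0 a1 aN1 a4] h1 h2 h3 e0 e1 e2 e3 e4 e5.
(* Multiplying a block equation by its scale removes the block size. *)
have f0 : a * (s1 * x0) = 2^-1 * (2 * x1 + x3 + x5).
  by rewrite -h1 mulrCA -e0; ring.
have f2 : a * (s2 * x2) = 6^-1 * (3 * x3 + x5).
  by rewrite -h2 mulrCA -e2; ring.
have f4 : a * (s3 * x4) = 4 / 3 * x5.
  by rewrite -h3 mulrCA -e4; ring.
have aD1 : a + 1 != 0 by rewrite addr_eq0.
have aB1 : a - 1 != 0 by rewrite subr_eq0.
have aB4 : a - 4 != 0 by rewrite subr_eq0.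
(* With [S = x1 + x3 + x5], the block terms of [a * (a * x1)] add up to [x1 + S], by
   [B^T B = I + J]. Hence [a^2 x1 - x1 = (a + 1) S], and [a + 1] cancels. *)
have g1 : (a - 1) * x1 = x1 + x3 + x5.
  apply: (mulfI aD1).
  have -> : (a + 1) * ((a - 1) * x1) = a * (a * x1) - x1 by ring.
  by rewrite -{}e1; lra.
have g3 : (a - 1) * x3 = x1 + x3 + x5.
  apply: (mulfI aD1).
  have -> : (a + 1) * ((a - 1) * x3) = a * (a * x3) - x3 by ring.
  by rewrite -{}e3; lra.
have g5 : (a - 1) * x5 = x1 + x3 + x5.
  apply: (mulfI aD1).
  have -> : (a + 1) * ((a - 1) * x5) = a * (a * x5) - x5 by ring.
  by rewrite -{}e5; lra.
(* Adding the three equations gives [(a - 1) S = 3 S]. *)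
have sum0 : x1 + x3 + x5 = 0.
  by apply: (mulfI aB4); rewrite mulr0; lra.
have z x : (a - 1) * x = x1 + x3 + x5 -> x = 0.
  by rewrite sum0 => ax; apply: (mulfI aB1); rewrite mulr0.
rewrite (z _ g1) (z _ g3) (z _ g5) in e0 e2 e4 *.
by do 2! split => //; apply: (mulfI a0); rewrite -?e0 -?e2 -?e4; ring.
Qed.
Lemma weight_eigenvalue (a : R) :
  eigenvalue (weight *m diag_mx (\row_c (count_mem c cells)%:R)) a ->
  a \in [:: 0; 1; -1; 4].
Proof.
move=> /eigenvalueP[u /rowP uE u0].
have eqn d : \sum_c u 0 c * weight c d * (count_mem d cells)%:R = a * u 0 d.
  by move: (uE d); rewrite mulmxA mul_mx_diag !mxE => <-; rewrite mulr_suml.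
apply: contraNT u0 => aN.
move: (eqn (cell 0)) (eqn (cell 1)) (eqn (cell 2)) (eqn (cell 3)) (eqn (cell 4))
  (eqn (cell 5)).
rewrite !count_cells !sum_cells !mxE /upper_weight /= => e0 e1 e2 e3 e4 e5.
have [q1 q2 q3] := scale_sq.
have [||||||[z1 z3 z5] [z0 z2 z4]] := quotient_kernel (x0 := u 0 (cell 0))
  (x1 := u 0 (cell 1)) (x2 := u 0 (cell 2)) (x3 := u 0 (cell 3))
  (x4 := u 0 (cell 4)) (x5 := u 0 (cell 5)) aN q1 q2 q3.
- by rewrite -e0; ring.
- by rewrite -e1; ring.
- by rewrite -e2; ring.
- by rewrite -e3; ring.
- by rewrite -e4; ring.
- by rewrite -e5; ring.
apply/eqP/rowP => -[[|[|[|[|[|[|//]]]]]] i];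
  by rewrite (eq_irrelevance i isT) mxE.
Qed.

End Quotient.

Theorem theorem7p3 (R : realType) (n k1 k2 k3 : nat) (G : sgraph n)
    (hk1 : (1 <= k1)%N) (hk2 : (1 <= k2)%N) (hk3 : (1 <= k3)%N)
    (hG : is_threshold G
      (nseq k1 false ++ [:: true] ++ nseq k2 false ++ [:: true]
        ++ nseq k3 false ++ [:: true])) :
  (min_num_eigenvalues R G <= 4)%N.
Proof.
have -> : 4%N = size [:: 0; 1; -1; 4 : R] by [].
have: is_threshold G [seq odd (val c) | c <- cells k1 k2 k3].
  by rewrite /cells !map_cat !map_nseq.
case=> /eqP + _ [v Gv]; rewrite size_map => sz.
(* [v] sends creation positions to vertices, so its inverse locates the cell of a vertex. *)
pose f i := tnth (Tuple sz) ((v^-1)%g i).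
pose W := weight R k1 k2 k3.
have fE (i j : 'I_n) : (i < j)%N ->
    (W (f (v i)) (f (v j)) != 0) = G (v i) (v j).
  move=> ij; have jn : (j < size (cells k1 k2 k3))%N by rewrite (eqP sz).
  rewrite Gv // /f !permK (nth_map ord0) // !(tnth_nth ord0) weight_neq0 //.
  have /pairwiseP := cells_sorted k1 k2 k3; apply => //.
  by rewrite inE (ltn_trans ij).
have symA : symm_class G (mxsub f f W).
  split; first by rewrite trmx_mxsub weight_sym.
  move=> i j; rewrite mxE -(permKV v i) -(permKV v j) (inj_eq perm_inj).
  case: (ltngtP ((v^-1)%g i) ((v^-1)%g j)) => [ij _|ji _|/val_inj ->].
  - exact: fE.
  - by rewrite adj_sym -fE // /W -[in LHS]weight_sym mxE.
  - by rewrite eqxx.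
apply: leq_trans (min_num_eigenvalues_le symA) _.
apply: num_eigenvalues_le => a Aa.
(* The passage to the quotient only covers nonzero eigenvalues. *)
have [->|a0] := eqVneq a 0; first by rewrite inE eqxx.
apply: (@weight_eigenvalue R k1 k2 k3) => //.
suff -> : \row_c (count_mem c (cells k1 k2 k3))%:R = fiber_sizes R f.
  exact: eigenvalue_mxsub.
(* Reindexing along [v] turns fibre sizes into multiplicities in [cells]. *)
apply/rowP => c; rewrite !mxE -sum1_count -[cells _ _ _]/(tval (Tuple sz)).
rewrite big_tuple -sum1_card [in RHS](reindex_inj (@perm_inj _ v)) /=.
by congr _%:R; apply: eq_bigl => i; rewrite inE /f permK.
Qed.
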